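(* Let $n,m$ be positive integers and let $f$ be a holomorphic mapping of the unit ball $\mathbf{B}_n\subset\mathbf{C}^n$ into the unit ball $\mathbf{B}_m\subset\mathbf{C}^m$. (i) If $m\ge 2$, then $$\|f'(z)\|\le \frac{\sqrt{1-|f(z)|^2}}{1-|z|^2}\qquad\text{for all } z\in\mathbf{B}_n .$$ (ii) If $m=1$, then $$\|f'(z)\|\le \frac{1-|f(z)|^2}{1-|z|^2}\qquad\text{for all } z\in\mathbf{B}_n .$$ The inequalities in (i) and (ii) are sharp. In particular, one has the following sharp inequalities: $$\|f'(0)\|\le \begin{cases}\sqrt{1-|f(0)|^2}, & \text{if } m\ge 2,\\ 1-|f(0)|^2, & \text{if } m=1.\end{cases}$$
   Context: $\mathbf{B}_k=\{z\in\mathbf{C}^k: |z|<1\}$ is the open unit ball of $\mathbf{C}^k$ with respect to the Euclidean (Hermitian) norm $|\cdot|$. For a holomorphic mapping $f:\Omega\to\mathbf{C}^m$ with $\Omega\subset\mathbf{C}^n$, the Fréchet derivative $f'(z):\mathbf{C}^n\to\mathbf{C}^m$ is the unique linear map such that $f(z+h)=f(z)+f'(z)h+O(|h|^2)$, and the norm of a linear map $A:\mathbf{C}^n\to\mathbf{C}^m$ is $\|A\|=\sup_{|z|=1}|Az|$. *)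

(* Defs.v *)
From HB Require Import structures.
From mathcomp Require Import all_boot all_order all_algebra complex.
From mathcomp Require Import all_classical all_reals all_analysis.
Import Order.TTheory GRing.Theory Num.Theory numFieldNormedType.Exports.

Set Implicit Arguments.
Unset Strict Implicit.
Unset Printing Implicit Defensive.

Local Open Scope ring_scope.
Local Open Scope complex_scope.
Local Open Scope classical_set_scope.

(* The library attaches the modulus topology to R[i]^o and to abstract
   numFieldTypes, but not to R[i] itself. *)
HB.instance Definition _ (R : realType) := NormedModule.copy R[i] R[i]^o.

(* The canonical norm of the library on 'rV[R[i]]_n is the sup norm; it is used
   below only through [differentiable] and ['d], which do not depend on the
   choice of an equivalent norm.  All metric quantities use [enorm]. *)
Definition enorm {R : realType} {n : nat} (v : 'rV[R[i]]_n) : R :=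
  Num.sqrt (\sum_(j < n) Normc.normc (v ord0 j) ^+ 2).

Definition unit_ball (R : realType) (n : nat) : set 'rV[R[i]]_n :=
  [set z | enorm z < 1].
Arguments unit_ball : clear implicits.

Definition opnorm {R : realType} {n m : nat}
    (A : 'rV[R[i]]_n -> 'rV[R[i]]_m) : R :=
  sup [set enorm (A v) | v in [set v : 'rV[R[i]]_n | enorm v = 1]].

(* Differentiability is over the field R[i]: ['d f z] is C-linear.
   [unit_ball] is open, so only the values of f on it matter. *)
Definition holomorphic_ball_map {R : realType} {n m : nat}
    (f : 'rV[R[i]]_n -> 'rV[R[i]]_m) : Prop :=
  (forall z, unit_ball R n z -> differentiable f z) /\
  (forall z, unit_ball R n z -> unit_ball R m (f z)).

(* Main.v *)
(* Restricting [f] to a complex line through [z] and reparametrising the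
   resulting disc by a Moebius map sending its centre to [z] reduces both
   inequalities to maps F of the unit disc into the ball, at the origin.  There
   |F(0)|^2 + |F'(0)|^2 <= 1 holds in every dimension; for m = 1, composing
   with a Moebius map that sends F(0) to 0 improves it to
   |F'(0)| <= 1 - |F(0)|^2.

   For the Parseval-type inequality put a = F(0), b = F'(0) and
   g(t) = <F(t), a> + <F(t) - a, b> / t, which tends to |a|^2 + |b|^2 at 0.  On
   |t| = r one has Re g <= (1 + |a|^2 + |b|^2 / r^2) / 2 by completing a square,
   so the maximum principle for Re g and r -> 1 give the claim.  The maximum
   principle comes from Goursat's theorem for g o exp on the rectangle
   [log r0, log r] x [0, 2 pi], whose horizontal sides cancel by periodicity. *)

Require Import Defs.
From HB Require Import structures.
From mathcomp Require Import all_boot all_order all_algebra complex.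
From mathcomp Require Import all_classical all_reals all_analysis.
From mathcomp Require Import ring lra.
Import Order.TTheory GRing.Theory Num.Theory numFieldNormedType.Exports.

Local Open Scope ring_scope.
Local Open Scope complex_scope.

Local Notation Re := complex.Re.
Local Notation Im := complex.Im.
Local Notation normc := (@Normc.normc _).

(* All calculus is done over an abstract [K] and only then specialised: at
   [K := R[i]] itself, unifying the several normed-module structures of
   [R[i]] diverges. *)
Definition has_deriv {K : numFieldType} (g : K -> K) (z d : K) : Prop :=
  is_derive z 1 g d.

(** * One-variable derivative calculus and its link with Fréchet differentials *)

Section HasDeriv.
Local Open Scope classical_set_scope.
Variable K : numFieldType.
Implicit Types (g h : K -> K) (z c d e : K).

(** Multiplying the difference quotient by [t] gives a first-order expansion without division; at
    [t = 0] both sides vanish, so the punctured neighbourhood becomes a full one. *)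
Lemma has_derivP g z d : has_deriv g z d <->
  forall e, 0 < e -> exists2 r : K, 0 < r &
    forall t : K, `|t| < r -> `|g (z + t) - g z - d * t| <= e * `|t|.
Proof.
have slope (t : K) : t != 0 ->
    `|d - t^-1 *: (g (t *: (1 : K) + z) - g z)| * `|t| =
    `|g (z + t) - g z - d * t|.
  move=> t0; rewrite -normrM -normrN -mulNr opprB mulrBl.
  by rewrite /GRing.scale/= mulr1 mulrAC mulVf// mul1r (addrC t z).
split=> [[/= gz dE] e e0|H].
- have /cvgrPdist_le/(_ e e0)[r /= r0 Hr] :
      (fun t : K => t^-1 *: (g (t *: (1 : K) + z) - g z)) @ 0^' --> d.
    by rewrite -dE; exact: gz.
  exists r => // t tr; have [->|t0] := eqVneq t 0.
    by rewrite addr0 mulr0 normr0 subr0 subrr normr0 mulr0.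
  rewrite -slope//; apply: ler_wpM2r => //; apply: Hr => //=.
  by rewrite sub0r normrN.
- have cd : (fun t : K => t^-1 *: (g (t *: (1 : K) + z) - g z)) @ 0^' --> d.
    apply/cvgrPdist_le => e /= /H[r r0 Hr]; exists r => //= t.
    rewrite /ball_/= sub0r normrN => tr t0.
    rewrite -(ler_pM2r (_ : 0 < `|t|)) ?normr_gt0// slope//; exact: Hr.
  split; last exact/cvg_lim.
  by apply/cvg_ex; exists d.
Qed.

Lemma has_deriv_eq g z d d' : has_deriv g z d -> d = d' -> has_deriv g z d'.
Proof. by move=> gd <-. Qed.

Lemma has_deriv_cst c z : has_deriv (fun=> c) z 0.
Proof. exact: is_derive_cst. Qed.

Lemma has_deriv_id z : has_deriv (fun x => x) z 1.
Proof. exact: is_derive_id. Qed.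

Lemma has_derivD g h z c d : has_deriv g z c -> has_deriv h z d ->
  has_deriv (fun x => g x + h x) z (c + d).
Proof. by move=> gc hd; apply: is_deriveD. Qed.

Lemma has_derivB g h z c d : has_deriv g z c -> has_deriv h z d ->
  has_deriv (fun x => g x - h x) z (c - d).
Proof. by move=> gc hd; apply: is_deriveB. Qed.

Lemma has_derivM g h z c d : has_deriv g z c -> has_deriv h z d ->
  has_deriv (fun x => g x * h x) z (g z * d + h z * c).
Proof. by move=> gc hd; apply: is_deriveM. Qed.

Lemma has_deriv_sum m (g : 'I_m -> K -> K) z (d : 'I_m -> K) :
  (forall j, has_deriv (g j) z (d j)) ->
  has_deriv (fun x => \sum_j g j x) z (\sum_j d j).
Proof.
move=> gd; rewrite /has_deriv.
rewrite (_ : (fun x => _) = \sum_j g j); first exact: is_derive_sum.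
by apply/funext => x; rewrite fct_sumE.
Qed.

Lemma has_derivV g z d : g z != 0 -> has_deriv g z d ->
  has_deriv (fun x => (g x)^-1) z (- d / g z ^+ 2).
Proof.
move=> gz [gd dE]; split; first exact: derivableV.
by rewrite deriveV// dE /GRing.scale/= mulrC mulrN -mulNr.
Qed.

Lemma has_deriv_comp g h z c d : has_deriv g z c -> has_deriv h (g z) d ->
  has_deriv (fun x => h (g x)) z (d * c).
Proof.
move=> [/derivable1_diffP gd gE] [/derivable1_diffP hd hE].
have hg : differentiable (h \o g) z by exact: differentiable_comp.
split; first by apply/derivable1_diffP.
have dgE : 'd g z 1 = c by rewrite -deriveE.
rewrite (deriveE _ hg) (diff_comp gd hd)/=.
transitivity ('d h (g z) c); first exact: congr1 dgE.
by rewrite -[in LHS](mulr1 c) -/(GRing.scale c (1 : K)) linearZ/= -deriveE// hE mulrC.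
Qed.

(** The bridge from ['d f] to one-variable derivatives: the chain rule runs through the affine line
    [l], then [f], then a coordinate projection, which is linear and hence its own differential. *)
Lemma has_deriv_coord_line n m (f : 'rV[K]_n -> 'rV[K]_m) q p v z d j :
  differentiable f (p + q z *: v) -> has_deriv q z d ->
  has_deriv (fun x => f (p + q x *: v) ord0 j) z
    (d * 'd f (p + q z *: v) v ord0 j).
Proof.
move=> fd [/derivable1_diffP qd qE].
pose l (x : K) := p + q x *: v.
have ld : is_diff z l (fun x => 'd q z x *: v).
  have q_v : is_diff z (fun x => q x *: v) (fun x => 'd q z x *: v).
    by apply: DiffDef; [exact: differentiableZl|exact: diffZl].
  have := is_diffD (is_diff_cst p z) q_v.
  by rewrite add0r.
pose pr (M : 'rV[K]_m) : K := M ord0 j.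
have prd (M : 'rV[K]_m) : differentiable pr M by exact: differentiable_coord.
have fl : differentiable (f \o l) z by exact: differentiable_comp.
have pfl : differentiable (pr \o (f \o l)) z by exact: differentiable_comp.
split; first exact: (iffRL (derivable1_diffP _ _) pfl).
rewrite -[LHS]/('D_1 (pr \o (f \o l)) z) deriveE//.
rewrite diff_comp// diff_comp//=.
have -> : 'd pr ((f \o l) z) = pr :> ('rV[K]_m -> K).
  have pr_lin : linear pr by move=> a M N; rewrite /pr !mxE.
  pose prM := GRing.isLinear.Build _ _ _ _ pr pr_lin.
  pose lpr : {linear 'rV[K]_m -> K} := HB.pack pr prM.
  rewrite -[pr]/(lpr : _ -> _) diff_lin//.
  by move=> M; exact: differentiable_continuous.
rewrite diff_val -(deriveE _ qd) qE linearZ/= /pr.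
by rewrite mxE.
Qed.

Lemma is_diff_lin_form n (c : 'cV[K]_n) (z : 'rV[K]_n) :
  is_diff z (fun x : 'rV[K]_n => (x *m c) ord0 ord0)
            (fun x => (x *m c) ord0 ord0).
Proof.
pose l (x : 'rV[K]_n) : K := (x *m c) ord0 ord0.
have l_lin : linear l.
  by move=> a M N; rewrite /l mulmxDl -scalemxAl !mxE.
pose lM := GRing.isLinear.Build _ _ _ _ l l_lin.
pose ll : {linear 'rV[K]_n -> K} := HB.pack l lM.
(* Differentiability comes from the sum over coordinates; it supplies the continuity with which
   [diff_lin] identifies the form as its own differential. *)
have ld x : differentiable l x.
  rewrite (_ : l = \sum_(j < n) (fun x : 'rV[K]_n => x ord0 j * c j ord0)).
    apply: differentiable_sum => j; apply: differentiableM => //.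
    exact: differentiable_coord.
  by apply/funext => y; rewrite fct_sumE /l mxE.
apply: DiffDef => //; rewrite -[X in 'd X _]/(ll : _ -> _) diff_lin//.
by move=> x; exact: (differentiable_continuous (ld x)).
Qed.

(** Supplies holomorphy and the differential of the extremal maps, which vary with one linear
    coordinate and take values on the line through [w] in direction [u]. *)
Lemma is_diff_ridge n m (phi : K -> K) (c : 'cV[K]_n) (w u : 'rV[K]_m)
    (z : 'rV[K]_n) d :
  has_deriv phi ((z *m c) ord0 ord0) d ->
  is_diff z (fun x : 'rV[K]_n => w + phi ((x *m c) ord0 ord0) *: u)
    (fun v => (d * (v *m c) ord0 ord0) *: u).
Proof.
move=> [/derivable1_diffP phid phiE].
have [ld lE] := @is_diff_lin_form n c z.
have pld : differentiable (phi \o fun x : 'rV[K]_n => (x *m c) ord0 ord0) z.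
  exact: differentiable_comp.
have pl : is_diff z
    (fun x : 'rV[K]_n => (phi \o fun y => (y *m c) ord0 ord0) x *: u)
    (fun v => (d * (v *m c) ord0 ord0) *: u).
  apply: DiffDef; first exact: differentiableZl.
  rewrite diffZl//; apply/funext => v; rewrite diff_comp//= lE.
  move: ((v *m c) ord0 ord0) => t.
  have -> : 'd phi ((z *m c) ord0 ord0) t = t *: 'd phi ((z *m c) ord0 ord0) 1.
    by rewrite -linearZ /GRing.scale/= mulr1.
  by rewrite -deriveE// phiE mulrC.
by have := is_diffD (is_diff_cst w z) pl; rewrite add0r.
Qed.

End HasDeriv.

(** * Nested intervals and bisection of rectangles *)

Section Bisection.
Local Open Scope classical_set_scope.

Lemma exists_half_expn_lt {R : realType} (D e : R) : 0 <= D -> 0 < e ->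
  exists n, D * 2^-1 ^+ n < e.
Proof.
move=> D0 e0; exists (Num.truncn (D / e)).+1.
have n0 : 0 < (2 : R) ^+ (Num.truncn (D / e)).+1 by rewrite exprn_gt0.
rewrite exprVn ltr_pdivrMr// mulrC -ltr_pdivrMr//.
apply: (lt_trans (truncnS_gt _)).
by rewrite -natrX ltr_nat ltn_expl.
Qed.

(** The supremum of the left ends works: any left end is below any right end, as one sees by
    comparing both at the larger index. *)
Lemma nested_intervals {R : realType} (u v : nat -> R) :
  (forall n, u n <= u n.+1) -> (forall n, v n.+1 <= v n) ->
  (forall n, u n <= v n) -> exists x, forall n, u n <= x <= v n.
Proof.
move=> ui vd uv.
have um : {homo u : m n / (m <= n)%N >-> m <= n}.
  by apply: homo_leq => //; exact: le_trans.
have vm : {homo v : m n / (m <= n)%N >-> n <= m}.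
  by apply: homo_leq => // x y z yx xz; exact: le_trans xz yx.
have uvmn m n : u m <= v n.
  apply: le_trans (um _ _ (leq_maxl m n)) _.
  exact: le_trans (uv _) (vm _ _ (leq_maxr m n)).
have ub n : ubound (range u) (v n) by move=> _ [m _ <-].
exists (sup (range u)) => n; apply/andP; split.
  by apply: ub_le_sup; [exists (v 0%N)|exists n].
by apply: ge_sup; [exists (u 0%N), 0%N|exact: ub].
Qed.

(* Goursat's bisection argument, isolated from the integrals. *)
Lemma additive_rect_eq0 {R : realType} (Phi : R -> R -> R -> R -> R)
    (a b c d : R) : a <= b -> c <= d ->
  (forall a1 b1 c1 d1 m, a <= a1 -> a1 <= m -> m <= b1 -> b1 <= b ->
    c <= c1 -> c1 <= d1 -> d1 <= d ->
    Phi a1 b1 c1 d1 = Phi a1 m c1 d1 + Phi m b1 c1 d1) ->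
  (forall a1 b1 c1 d1 m, a <= a1 -> a1 <= b1 -> b1 <= b ->
    c <= c1 -> c1 <= m -> m <= d1 -> d1 <= d ->
    Phi a1 b1 c1 d1 = Phi a1 b1 c1 m + Phi a1 b1 m d1) ->
  (forall x y, a <= x <= b -> c <= y <= d -> forall e : R, 0 < e ->
    exists2 r : R, 0 < r & forall a1 b1 c1 d1,
      a <= a1 -> a1 <= x <= b1 -> b1 <= b -> c <= c1 -> c1 <= y <= d1 ->
      d1 <= d -> (b1 - a1) + (d1 - c1) < r ->
      `|Phi a1 b1 c1 d1| <= e * ((b1 - a1) + (d1 - c1)) ^+ 2) ->
  Phi a b c d = 0.
Proof.
move=> ab cd addx addy local.
apply/eqP; rewrite -normr_eq0; apply/negPn/negP => p_neq0.
set p := `|_| in p_neq0; have p0 : 0 < p by rewrite lt_neqAle eq_sym p_neq0 normr_ge0.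
pose q (n : nat) : R := 2^-1 ^+ n.
have q0 n : 0 < q n by rewrite exprn_gt0.
have qS n : q n.+1 = q n / 2 by rewrite /q exprSr.
pose w := b - a; pose h := d - c.
have w0 : 0 <= w by rewrite subr_ge0.
have h0 : 0 <= h by rewrite subr_ge0.
(* [u] is the lower left corner of a copy of the rectangle scaled by [2^-n], on which [Phi] keeps at
   least the share [4^-n] of [p]. *)
pose Bad n (u : R * R) := [/\ a <= u.1, u.1 + w * q n <= b, c <= u.2,
  u.2 + h * q n <= d &
  p * q n ^+ 2 <= `|Phi u.1 (u.1 + w * q n) u.2 (u.2 + h * q n)|].
pose Sub n (u u' : R * R) := [/\ u.1 <= u'.1,
  u'.1 + w * q n.+1 <= u.1 + w * q n, u.2 <= u'.2 &
  u'.2 + h * q n.+1 <= u.2 + h * q n].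
have step n u : Bad n u -> exists u', Bad n.+1 u' /\ Sub n u u'.
  case: u => a1 c1 [/= aa1 b1b cc1 d1d HPhi].
  set w1 := w * q n.+1; set h1 := h * q n.+1.
  have w10 : 0 <= w1 by rewrite mulr_ge0// ltW.
  have h10 : 0 <= h1 by rewrite mulr_ge0// ltW.
  have wE : w * q n = w1 + w1 by rewrite /w1 qS; field.
  have hE : h * q n = h1 + h1 by rewrite /h1 qS; field.
  move: HPhi; rewrite wE hE in b1b d1d *; rewrite !addrA in b1b d1d *.
  have [x1 x2] : a1 + w1 <= b /\ a <= a1 + w1.
    by move: w10 aa1 b1b; clear; split; lra.
  have y1 : c1 + h1 <= d by move: h10 d1d; clear; lra.
  have yy : c1 <= c1 + h1 + h1 by move: h10; clear; lra.
  rewrite (addx a1 (a1 + w1 + w1) c1 (c1 + h1 + h1) (a1 + w1)) ?lerDl//.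
  rewrite (addy a1 (a1 + w1) c1 (c1 + h1 + h1) (c1 + h1)) ?lerDl//.
  rewrite (addy (a1 + w1) (a1 + w1 + w1) c1 (c1 + h1 + h1) (c1 + h1)) ?lerDl//.
  set P1 := Phi a1 _ c1 _; set P2 := Phi a1 _ _ _; set P3 := Phi _ _ c1 _.
  set P4 := Phi _ _ _ _ => HPhi.
  have qq : q n ^+ 2 = 4 * q n.+1 ^+ 2 by rewrite qS; field.
  (* If all four quarters fell below a quarter of the bound, the triangle inequality would
     contradict it. *)
  have {HPhi}: [|| p * q n.+1 ^+ 2 <= `|P1|, p * q n.+1 ^+ 2 <= `|P2|,
                 p * q n.+1 ^+ 2 <= `|P3| | p * q n.+1 ^+ 2 <= `|P4|].
    move: HPhi (ler_normD (P1 + P2) (P3 + P4)) (ler_normD P1 P2) (ler_normD P3 P4).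
    rewrite qq mulrCA; move: (p * _) `|P1| `|P2| `|P3| `|P4| `|P1 + P2| `|P3 + P4|.
    clear => t T1 T2 T3 T4 T12 T34 HPhi H1 H2 H3; apply/negPn/negP.
    by rewrite !negb_or -!ltNge => /and4P[]; lra.
  case/or4P => HP;
    [exists (a1, c1)|exists (a1, c1 + h1)|exists (a1 + w1, c1)|
     exists (a1 + w1, c1 + h1)];
    (split; split => //=; rewrite ?wE ?hE -?/w1 -?/h1);
    move: w10 h10 aa1 b1b cc1 d1d; clear; lra.
(* The step is made total, with [u] itself as default outside [Bad], so that choice yields a
   function to iterate. *)
have /choice[g Hg] : forall nu : nat * (R * R), exists u', Bad nu.1 nu.2 ->
    Bad nu.1.+1 u' /\ Sub nu.1 nu.2 u'.
  case=> n u; have [Hu|Hu] := pselect (Bad n u); last by exists u.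
  by have [u' Hu'] := step _ _ Hu; exists u'.
pose u := fix u n := if n is n'.+1 then g (n', u n') else (a, c).
have uBad n : Bad n (u n).
  elim: n => [|n IH]; last by case: (Hg (n, u n) IH).
  by split => //=; rewrite /w /h /q expr0 ?expr1n !mulr1 ?[_ + (_ - _)]addrC ?subrK.
have uSub n : Sub n (u n) (u n.+1) by case: (Hg (n, u n) (uBad n)).
have [x Hx] : exists x, forall n, (u n).1 <= x <= (u n).1 + w * q n.
  apply: nested_intervals => n; [by case: (uSub n)|by case: (uSub n)|].
  by rewrite lerDl mulr_ge0// ltW.
have [y Hy] : exists y, forall n, (u n).2 <= y <= (u n).2 + h * q n.
  apply: nested_intervals => n; [by case: (uSub n)|by case: (uSub n)|].
  by rewrite lerDl mulr_ge0// ltW.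
have xab : a <= x <= b.
  by have := Hx 0%N; rewrite /= /q expr0 /w mulr1 addrC subrK.
have ycd : c <= y <= d.
  by have := Hy 0%N; rewrite /= /q expr0 /h mulr1 addrC subrK.
(* The added 1 keeps [D] positive even for a degenerate rectangle. With tolerance [p / D] the local
   bound at [(x, y)] falls below [p * q n ^+ 2], against [Bad]. *)
pose D := (w + h) ^+ 2 + 1.
have D0 : 0 < D by rewrite ltr_wpDl// sqr_ge0.
have e0 : 0 < p / D by rewrite divr_gt0.
have [r r0 Hr] := local x y xab ycd _ e0.
have wh0 : 0 <= w + h by rewrite addr_ge0.
have [n Hn] := exists_half_expn_lt _ _ wh0 r0.
have [H1 H2 H3 H4] := uBad n.
have sE : (u n).1 + w * q n - (u n).1 + ((u n).2 + h * q n - (u n).2) =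
          (w + h) * q n by ring.
have := Hr _ _ _ _ H1 (Hx n) H2 H3 (Hy n) H4; rewrite sE => /(_ Hn) H5 H6.
have : p * q n ^+ 2 <= p / D * (w + h) ^+ 2 * q n ^+ 2.
  by apply: le_trans H6 _; rewrite -mulrA -exprMn.
rewrite ler_pM2r ?exprn_gt0// leNgt => /negP; apply.
by rewrite mulrAC ltr_pdivrMr// ltr_pM2l// /D ltrDl.
Qed.

End Bisection.

(** * The real-valued modulus and real forms of complex differentiability *)

Section Normc.
Variable R : realType.
Implicit Types (x y z : R[i]).

Lemma normc_sqrtE z : normc z = Num.sqrt (Re z ^+ 2 + Im z ^+ 2).
Proof. by case: z. Qed.

Lemma sqr_normc_def z : normc z ^+ 2 = Re z ^+ 2 + Im z ^+ 2.
Proof. by rewrite normc_sqrtE sqr_sqrtr// addr_ge0// sqr_ge0. Qed.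

Lemma normc_norm z : (normc z)%:C = `|z|.
Proof. by rewrite normc_def normc_sqrtE. Qed.

Lemma normc_ge0 z : 0 <= normc z.
Proof. by rewrite normc_sqrtE sqrtr_ge0. Qed.

Lemma normr_Re_le z : `|Re z| <= normc z.
Proof. by rewrite normc_sqrtE -sqrtr_sqr ler_sqrt ?lerDl ?sqr_ge0// addr_ge0 ?sqr_ge0. Qed.

Lemma normr_Im_le z : `|Im z| <= normc z.
Proof. by rewrite normc_sqrtE -sqrtr_sqr ler_sqrt ?lerDr ?sqr_ge0// addr_ge0 ?sqr_ge0. Qed.

Lemma normc_le_ReIm z : normc z <= `|Re z| + `|Im z|.
Proof.
rewrite -(ler_sqr (_ : _ \is Num.nneg)) ?nnegrE ?normc_ge0 ?addr_ge0//.
rewrite sqr_normc_def sqrrD !real_normK ?num_real//.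
by rewrite lerD2r lerDl mulrn_wge0 // mulr_ge0.
Qed.

Lemma normc_real (a : R) : normc a%:C = `|a|.
Proof. by rewrite /= expr0n/= addr0 sqrtr_sqr. Qed.

(** A positive element of [R[i]] is the image of a positive real, since the order forces its
    imaginary part to vanish; tolerances and radii can therefore be real. *)
Lemma has_deriv_normcP (g : R[i] -> R[i]) z d : has_deriv g z d <->
  forall e : R, 0 < e -> exists2 r : R, 0 < r & forall t, normc t < r ->
    normc (g (z + t) - g z - d * t) <= e * normc t.
Proof.
have realE (x : R[i]) : 0 < x -> exists2 a : R, 0 < a & x = a%:C.
  case: x => a b; rewrite ltcE /= => /andP[/eqP -> a0]; by exists a.
rewrite has_derivP; split=> H e e0.
- have [|_ /realE[r r0 ->] Hr] := H e%:C; first by rewrite ltcR.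
  exists r => // t tr; rewrite -lecR rmorphM/= !normc_norm; apply: Hr.
  by rewrite -normc_norm ltcR.
- have [a a0 ->] := realE _ e0.
  have [r r0 Hr] := H _ a0; exists r%:C; first by rewrite ltcR.
  move=> t; rewrite -!normc_norm ltcR => /Hr.
  by rewrite -lecR rmorphM.
Qed.

(** The Cauchy-Riemann equations are implicit: both real expansions take their coefficients from the
    same [d]. The l1 distance, which dominates the modulus, is convenient on rectangles. *)
Lemma has_deriv_ReIm (g : R[i] -> R[i]) (x y : R) d : has_deriv g (x +i* y) d ->
  forall e : R, 0 < e -> exists2 r : R, 0 < r & forall s t : R,
    `|s - x| + `|t - y| < r ->
    `|Re (g (s +i* t)) - Re (g (x +i* y)) - (Re d * (s - x) - Im d * (t - y))|
      <= e * (`|s - x| + `|t - y|) /\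
    `|Im (g (s +i* t)) - Im (g (x +i* y)) - (Im d * (s - x) + Re d * (t - y))|
      <= e * (`|s - x| + `|t - y|).
Proof.
move=> /has_deriv_normcP H e e0; have [r r0 Hr] := H e e0.
exists r => // s t st.
have stE : s +i* t = (x +i* y) + ((s - x) +i* (t - y)) :> R[i].
  by apply/eqP; rewrite eq_complex /= ![_ + (_ - _)]addrC !subrK !eqxx.
have le1 := normc_le_ReIm ((s - x) +i* (t - y)).
have {}Hr := Hr _ (le_lt_trans le1 st); rewrite -stE in Hr.
have {Hr}le2 := le_trans Hr (ler_wpM2l (ltW e0) le1).
split; apply: le_trans le2.
- apply: le_trans (normr_Re_le _); move: (g _) (g _) => [? ?] [? ?].
  by case: (d) => ? ? /=.
- apply: le_trans (normr_Im_le _); move: (g _) (g _) => [? ?] [? ?].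
  by case: (d) => ? ? /=; rewrite [X in _ - X]addrC.
Qed.

End Normc.

(** * Integral estimates and Goursat's theorem on rectangles *)

Section Goursat.
Local Open Scope classical_set_scope.
Variable R : realType.
Local Notation mu := (@lebesgue_measure R).
Implicit Types (u v : R -> R) (a b k e : R).

Lemma integrable_within_continuous u a b :
  {within `[a, b], continuous u} -> mu.-integrable `[a, b] (EFin \o u).
Proof. by apply: continuous_compact_integrable; exact: segment_compact. Qed.

Lemma Rintegral_cat u a m b : a <= m -> m <= b ->
  {within `[a, b], continuous u} ->
  \int[mu]_(x in `[a, b]) u x =
  \int[mu]_(x in `[a, m]) u x + \int[mu]_(x in `[m, b]) u x.
Proof.
move=> am mb /integrable_within_continuous ui.
have mbi : mu.-integrable `]m, b] (EFin \o u).
  apply: integrableS ui => //; apply: subset_itv; rewrite bnd_simp//.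
rewrite -(Rintegral_itv_obnd_cbnd mbi) -(Rintegral_itvB (x := m) ui) ?bnd_simp//.
by rewrite addrC subrK.
Qed.

Lemma integrable_cst_itv k a b : mu.-integrable `[a, b] (EFin \o cst k).
Proof.
apply: integrable_within_continuous.
by apply: continuous_subspaceT => x; exact: cst_continuous.
Qed.

Lemma Rintegral_cst_itv k a b : a <= b ->
  \int[mu]_(x in `[a, b]) cst k x = k * (b - a).
Proof.
move=> ab; rewrite Rintegral_cst//= lebesgue_measure_itv/= lte_fin.
by move: ab; rewrite le_eqVlt => /predU1P[->|->]//; rewrite ltxx subrr.
Qed.

Lemma Rintegral_le_cst u a b k : a <= b -> {within `[a, b], continuous u} ->
  (forall x, a <= x <= b -> u x <= k) ->
  \int[mu]_(x in `[a, b]) u x <= k * (b - a).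
Proof.
move=> ab uc uk; rewrite -Rintegral_cst_itv//; apply: le_Rintegral.
- by [].
- exact: integrable_within_continuous.
- exact: integrable_cst_itv.
- by move=> x /=; rewrite in_itv; exact: uk.
Qed.

Lemma Rintegral_ge_cst u a b k : a <= b -> {within `[a, b], continuous u} ->
  (forall x, a <= x <= b -> k <= u x) ->
  k * (b - a) <= \int[mu]_(x in `[a, b]) u x.
Proof.
move=> ab uc uk; rewrite -Rintegral_cst_itv//; apply: le_Rintegral.
- by [].
- exact: integrable_cst_itv.
- exact: integrable_within_continuous.
- by move=> x /=; rewrite in_itv; exact: uk.
Qed.

Lemma Rintegral_approx u a b k e : a <= b ->
  {within `[a, b], continuous u} ->
  (forall x, a <= x <= b -> `|u x - k| <= e) ->
  `|\int[mu]_(x in `[a, b]) u x - k * (b - a)| <= e * (b - a).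
Proof.
move=> ab uc Hu; rewrite ler_distl -mulrBl -mulrDl; apply/andP; split.
- by apply: Rintegral_ge_cst => // x /Hu; rewrite ler_distl => /andP[].
- by apply: Rintegral_le_cst => // x /Hu; rewrite ler_distl => /andP[].
Qed.

Lemma continuous_at_dist u (y : R) :
  (forall e, 0 < e -> exists2 r : R, 0 < r & forall t : R, `|t - y| < r ->
    `|u t - u y| <= e) -> {for y, continuous u}.
Proof.
move=> H; apply/cvgrPdist_le => e /H[r r0 Hr]; exists r => //= t.
by rewrite /ball_/= distrC => /Hr; rewrite distrC.
Qed.

(** This slice and the next are those integrated in [goursat_rect]: real parts along vertical sides,
    imaginary parts along horizontal ones. *)
Lemma has_deriv_continuous_Re (G : R[i] -> R[i]) (x y : R) D :
  has_deriv G (x +i* y) D -> {for y, continuous (fun t : R => Re (G (x +i* t)))}.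
Proof.
move=> /has_deriv_ReIm/(_ 1 ltr01)[r r0 Hr]; apply: continuous_at_dist => e e0.
have M0 : 0 < `|Im D| + 1 by rewrite ltr_wpDl.
(* The expansion with tolerance 1 bounds the increment by [|Im D| + 1] times the distance from [t]
   to [y]. *)
exists (Num.min r (e / (`|Im D| + 1))); first by rewrite lt_min r0 divr_gt0.
move=> t; rewrite lt_min ltr_pdivlMr// => /andP[tr te].
have [|+ _] := Hr x t; first by rewrite subrr normr0 add0r.
rewrite subrr normr0 add0r mulr0 sub0r opprK mul1r => H.
have := ler_normB (Re (G (x +i* t)) - Re (G (x +i* y)) + Im D * (t - y))
  (Im D * (t - y)); rewrite addrK normrM => /le_trans; apply.
by apply: le_trans (ltW te); rewrite [leRHS]mulrDr mulr1 [leRHS]addrC lerD// mulrC.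
Qed.

Lemma has_deriv_continuous_Im (G : R[i] -> R[i]) (x y : R) D :
  has_deriv G (x +i* y) D -> {for x, continuous (fun s : R => Im (G (s +i* y)))}.
Proof.
move=> /has_deriv_ReIm/(_ 1 ltr01)[r r0 Hr]; apply: continuous_at_dist => e e0.
have M0 : 0 < `|Im D| + 1 by rewrite ltr_wpDl.
exists (Num.min r (e / (`|Im D| + 1))); first by rewrite lt_min r0 divr_gt0.
move=> t; rewrite lt_min ltr_pdivlMr// => /andP[tr te].
have [|_] := Hr t y; first by rewrite subrr normr0 addr0.
rewrite subrr normr0 addr0 mulr0 addr0 mul1r => H.
have := ler_normD (Im (G (t +i* y)) - Im (G (x +i* y)) - Im D * (t - x))
  (Im D * (t - x)); rewrite subrK normrM => /le_trans; apply.
by apply: le_trans (ltW te); rewrite [leRHS]mulrDr mulr1 [leRHS]addrC lerD// mulrC.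
Qed.

(** This is the imaginary part of Cauchy's theorem for the boundary of the rectangle. The difference
    of the two sides is additive under subdivision, and differentiability at a point makes it
    negligible against the squared size of small rectangles around it, so bisection applies. *)
Lemma goursat_rect (G : R[i] -> R[i]) a b (c d : R) : a <= b -> c <= d ->
  (forall s t : R, a <= s <= b -> c <= t <= d ->
    exists D, has_deriv G (s +i* t) D) ->
  \int[mu]_(t in `[c, d]) (Re (G (b +i* t)) - Re (G (a +i* t))) =
  \int[mu]_(s in `[a, b]) (Im (G (s +i* d)) - Im (G (s +i* c))).
Proof.
move=> ab cd HG.
have contRe a1 b1 c1 d1 : a <= a1 <= b -> a <= b1 <= b -> c <= c1 -> d1 <= d ->
    {within `[c1, d1], continuous (fun t => Re (G (b1 +i* t)) - Re (G (a1 +i* t)))}.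
  move=> ha hb hc hd; apply: continuous_in_subspaceT => t.
  rewrite inE/= in_itv/= => /andP[ct td].
  have tcd : c <= t <= d by rewrite (le_trans hc ct) (le_trans td hd).
  have [D1 H1] := HG _ _ ha tcd; have [D2 H2] := HG _ _ hb tcd.
  by apply: cvgB; [exact: has_deriv_continuous_Re H2|exact: has_deriv_continuous_Re H1].
have contIm a1 b1 c1 d1 : a <= a1 -> b1 <= b -> c <= c1 <= d -> c <= d1 <= d ->
    {within `[a1, b1], continuous (fun s => Im (G (s +i* d1)) - Im (G (s +i* c1)))}.
  move=> ha hb hc hd; apply: continuous_in_subspaceT => t.
  rewrite inE/= in_itv/= => /andP[ct td].
  have tcd : a <= t <= b by rewrite (le_trans ha ct) (le_trans td hb).
  have [D1 H1] := HG _ _ tcd hc; have [D2 H2] := HG _ _ tcd hd.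
  by apply: cvgB; [exact: has_deriv_continuous_Im H2|exact: has_deriv_continuous_Im H1].
pose Phi a b c d :=
  \int[mu]_(t in `[c, d]) (Re (G (b +i* t)) - Re (G (a +i* t))) -
  \int[mu]_(s in `[a, b]) (Im (G (s +i* d)) - Im (G (s +i* c))).
apply/eqP; rewrite -subr_eq0; apply/eqP; rewrite -/(Phi a b c d).
apply: additive_rect_eq0 => //.
- move=> a1 b1 c1 d1 m aa1 a1m mb1 b1b cc1 c1d1 d1d; rewrite /Phi.
  have c1cd : c <= c1 <= d by rewrite cc1 (le_trans c1d1).
  have d1cd : c <= d1 <= d by rewrite d1d (le_trans cc1).
  have mab : a <= m <= b by rewrite (le_trans aa1)// (le_trans mb1).
  have a1ab : a <= a1 <= b by rewrite aa1 (le_trans a1m)//; case/andP: mab.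
  have b1ab : a <= b1 <= b by rewrite b1b (le_trans _ mb1)//; case/andP: mab.
  rewrite (@Rintegral_cat _ a1 m b1)//; last exact: contIm.
  rewrite addrACA -opprD; congr (_ - _).
  rewrite -RintegralD//; last 2 first.
  + by apply: integrable_within_continuous; exact: contRe.
  + by apply: integrable_within_continuous; exact: contRe.
  by apply: eq_Rintegral => t _ /=; ring.
- move=> a1 b1 c1 d1 m aa1 a1b1 b1b cc1 c1m md1 d1d; rewrite /Phi.
  have mcd : c <= m <= d by rewrite (le_trans cc1)// (le_trans md1).
  have c1cd : c <= c1 <= d by rewrite cc1 (le_trans c1m)//; case/andP: mcd.
  have d1cd : c <= d1 <= d by rewrite d1d (le_trans _ md1)//; case/andP: mcd.
  have a1ab : a <= a1 <= b by rewrite aa1 (le_trans a1b1).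
  have b1ab : a <= b1 <= b by rewrite b1b (le_trans aa1).
  rewrite (@Rintegral_cat _ c1 m d1)//; last exact: contRe.
  rewrite addrACA -opprD; congr (_ - _).
  rewrite -RintegralD//; last 2 first.
  + by apply: integrable_within_continuous; exact: contIm.
  + by apply: integrable_within_continuous; exact: contIm.
  by apply: eq_Rintegral => t _ /=; ring.
move=> x y xab ycd e e0; have [D HD] := HG _ _ xab ycd.
(* Two expansions with tolerance [e / 4] enter each integrand, giving an error [e / 2 * L];
   integrating over sides of total length [L] gives [e / 2 * L ^+ 2]. *)
have e4 : 0 < e / 4 by rewrite divr_gt0.
have [r r0 Hr] := has_deriv_ReIm _ _ _ _ _ HD _ e4.
exists r => // a1 b1 c1 d1 aa1 /andP[a1x xb1] b1b cc1 /andP[c1y yd1] d1d whr.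
have a1b1 : a1 <= b1 by exact: le_trans xb1.
have c1d1 : c1 <= d1 by exact: le_trans yd1.
have c1cd : c <= c1 <= d by rewrite cc1 (le_trans c1d1).
have d1cd : c <= d1 <= d by rewrite d1d (le_trans cc1).
have a1ab : a <= a1 <= b by rewrite aa1 (le_trans a1b1).
have b1ab : a <= b1 <= b by rewrite b1b (le_trans aa1).
have close (s t : R) : a1 <= s <= b1 -> c1 <= t <= d1 ->
    `|s - x| + `|t - y| <= (b1 - a1) + (d1 - c1).
  move=> /andP[? ?] /andP[? ?]; apply: lerD; rewrite ler_norml; lra.
have a1I : a1 <= a1 <= b1 by rewrite lexx.
have b1I : a1 <= b1 <= b1 by rewrite lexx andbT.
have c1I : c1 <= c1 <= d1 by rewrite lexx.
have d1I : c1 <= d1 <= d1 by rewrite lexx andbT.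
set L := (b1 - a1) + (d1 - c1) in whr close *.
have I1 : `|\int[mu]_(t in `[c1, d1]) (Re (G (b1 +i* t)) - Re (G (a1 +i* t))) -
    Re D * (b1 - a1) * (d1 - c1)| <= e / 2 * L * (d1 - c1).
  apply: Rintegral_approx => //; first exact: contRe.
  move=> t tI.
  have B1 := close _ _ b1I tI; have B2 := close _ _ a1I tI.
  have [C1 _] := Hr b1 t (le_lt_trans B1 whr).
  have [C2 _] := Hr a1 t (le_lt_trans B2 whr).
  have := ler_normB
    (Re (G (b1 +i* t)) - Re (G (x +i* y)) - (Re D * (b1 - x) - Im D * (t - y)))
    (Re (G (a1 +i* t)) - Re (G (x +i* y)) - (Re D * (a1 - x) - Im D * (t - y))).
  rewrite [X in `|X| <= _ -> _](_ : _ = Re (G (b1 +i* t)) - Re (G (a1 +i* t)) -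
    Re D * (b1 - a1)); last by ring.
  move=> /le_trans; apply; apply: le_trans (lerD C1 C2) _.
  have -> : e / 2 * L = e / 4 * L + e / 4 * L by field.
  by apply: lerD; rewrite ler_pM2l.
have I2 : `|\int[mu]_(s in `[a1, b1]) (Im (G (s +i* d1)) - Im (G (s +i* c1))) -
    Re D * (d1 - c1) * (b1 - a1)| <= e / 2 * L * (b1 - a1).
  apply: Rintegral_approx => //; first exact: contIm.
  move=> s sI.
  have B1 := close _ _ sI d1I; have B2 := close _ _ sI c1I.
  have [_ C1] := Hr s d1 (le_lt_trans B1 whr).
  have [_ C2] := Hr s c1 (le_lt_trans B2 whr).
  have := ler_normB
    (Im (G (s +i* d1)) - Im (G (x +i* y)) - (Im D * (s - x) + Re D * (d1 - y)))
    (Im (G (s +i* c1)) - Im (G (x +i* y)) - (Im D * (s - x) + Re D * (c1 - y))).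
  rewrite [X in `|X| <= _ -> _](_ : _ = Im (G (s +i* d1)) - Im (G (s +i* c1)) -
    Re D * (d1 - c1)); last by ring.
  move=> /le_trans; apply; apply: le_trans (lerD C1 C2) _.
  have -> : e / 2 * L = e / 4 * L + e / 4 * L by field.
  by apply: lerD; rewrite ler_pM2l.
rewrite /Phi; move: I1 I2; set J1 := (\int[_]_(_ in _) _); set J2 := (\int[_]_(_ in _) _).
(* Both integrals have the main term [Re D] times the area, which cancels in the difference. *)
move=> I1 I2; have := ler_normB (J1 - Re D * (b1 - a1) * (d1 - c1))
  (J2 - Re D * (d1 - c1) * (b1 - a1)).
rewrite [X in `|X| <= _ -> _](_ : _ = J1 - J2); last by ring.
move=> /le_trans; apply; apply: le_trans (lerD I1 I2) _.
have -> : e / 2 * L * (d1 - c1) + e / 2 * L * (b1 - a1) = e / 2 * L ^+ 2.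
  by rewrite /L; field.
rewrite ler_wpM2r ?sqr_ge0//.
by rewrite ler_pdivrMr// mulr_natr mulr2n lerDl ltW.
Qed.

End Goursat.

(** * The complex exponential *)

Section ComplexExp.
Variable R : realType.
Implicit Types (w z t : R[i]) (a b e : R).

Definition cexp w : R[i] :=
  (expR (Re w) * cos (Im w)) +i* (expR (Re w) * sin (Im w)).

Lemma cexpD w z : cexp (w + z) = cexp w * cexp z.
Proof.
case: w z => [a b] [x y]; rewrite /cexp /= expRD cosD sinD.
by apply/eqP; rewrite eq_complex /=; apply/andP; split; apply/eqP; ring.
Qed.

Lemma normc_cexp w : normc (cexp w) = expR (Re w).
Proof.
rewrite normc_sqrtE/= !exprMn -mulrDr cos2Dsin2 mulr1.
by rewrite sqrtr_sqr ger0_norm ?expR_ge0.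
Qed.

Lemma cexp_2pi a b : cexp (a +i* (b + pi *+ 2)) = cexp (a +i* b).
Proof. by rewrite /cexp /= cosD2pi sinD2pi. Qed.

(** The functional equation moves the question to 0, where the real derivatives of exp, cos and sin
    suffice. *)
Lemma has_deriv_cexp w : has_deriv cexp w (cexp w).
Proof.
apply/has_deriv_normcP => e e0.
pose M := normc (cexp w).
have M0 : 0 < M by rewrite /M normc_cexp expR_gt0.
(* The factor 9 adds up the four error terms estimated at the end, with constants 3, 1, 3 and 2; [M]
   is the modulus of the factor [cexp w]. *)
have [k [k0 k1 kM]] : exists k, [/\ 0 < k, k <= 1 & 9 * k * M <= e].
  exists (Num.min 1 (e / (9 * M))); split.
  - by rewrite lt_min ltr01 divr_gt0 ?mulr_gt0.
  - by rewrite ge_min lexx.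
  - by rewrite mulrAC mulrC -ler_pdivlMr ?mulr_gt0// ge_min lexx orbT.
have dexp : has_deriv (@expR R) 0 1 by have := @is_derive_expR R 0; rewrite expR0.
have dcos : has_deriv (@cos R) 0 0.
  by have := @is_derive_cos R 0; rewrite sin0 oppr0.
have dsin : has_deriv (@sin R) 0 1 by have := @is_derive_sin R 0; rewrite cos0.
have [r1 r10 H1] := (has_derivP _ _ _ _).1 dexp k k0.
have [r2 r20 H2] := (has_derivP _ _ _ _).1 dcos k k0.
have [r3 r30 H3] := (has_derivP _ _ _ _).1 dsin k k0.
exists (Num.min k (Num.min r1 (Num.min r2 r3))); first by rewrite !lt_min k0 r10 r20.
move=> t; rewrite !lt_min => /and4P[tk t1 t2 t3].
have -> : cexp (w + t) - cexp w - cexp w * t = cexp w * (cexp t - 1 - t).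
  by rewrite cexpD; ring.
rewrite Normc.normcM -/M.
suff H : normc (cexp t - 1 - t) <= 9 * k * normc t.
  apply: le_trans (ler_wpM2l (ltW M0) H) _.
  by rewrite mulrA ler_wpM2r ?normc_ge0// mulrC.
apply: le_trans (normc_le_ReIm _ _) _.
have at_ := normr_Re_le _ t; have bt_ := normr_Im_le _ t.
case: t tk t1 t2 t3 at_ bt_ => a b; set n := normc _ => tk t1 t2 t3 /= at_ bt_.
have := H1 a (le_lt_trans at_ t1); have := H2 b (le_lt_trans bt_ t2).
have := H3 b (le_lt_trans bt_ t3); rewrite !add0r expR0 cos0 sin0 mul0r !mul1r !subr0.
move=> S3 S2 S1.
have a0 := normr_ge0 a; have b0 := normr_ge0 b.
have ea : `|expR a - 1| <= 2 * `|a|.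
  have := ler_normD (expR a - 1 - a) a; rewrite subrK => /le_trans; apply.
  rewrite mulr_natl mulr2n lerD2r; apply: le_trans S1 _.
  by rewrite ler_piMl.
have ea3 : `|expR a| <= 3.
  have := ler_normD (expR a - 1) 1; rewrite subrK normr1 => /le_trans; apply.
  by move: (ea) tk at_ k1; clear; lra.
have -> : expR a * cos b - 1 - a = expR a * (cos b - 1) + (expR a - 1 - a) by ring.
have -> : expR a * sin b - b = expR a * (sin b - b) + (expR a - 1) * b by ring.
have X1 := ler_normD (expR a * (cos b - 1)) (expR a - 1 - a).
have X2 := ler_normD (expR a * (sin b - b)) ((expR a - 1) * b).
rewrite !normrM in X1 X2.
have Y1 := ler_pM (normr_ge0 _) (normr_ge0 _) ea3 S2.
have Y2 := ler_pM (normr_ge0 _) (normr_ge0 _) ea3 S3.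
have Y3 := ler_pM (normr_ge0 _) (normr_ge0 _) ea (le_trans bt_ (ltW tk)).
have Z1 := ler_wpM2l (ltW k0) at_; have Z2 := ler_wpM2l (ltW k0) bt_.
apply: le_trans (lerD X1 X2) _; apply: le_trans (lerD (lerD Y1 S1) (lerD Y2 Y3)) _.
by move: Z1 Z2; rewrite -/n; clear; lra.
Qed.

End ComplexExp.

(** * Maximum principle on a punctured disc *)

Section MaximumPrinciple.
Local Open Scope classical_set_scope.

(** In the coordinate [log z] circles become vertical segments of length [2 pi], so by Goursat the
    mean of [Re g] over a circle does not depend on its radius. Were [Re L] larger than [M], the
    mean over a small circle would exceed the one over the circle of radius [r]. *)
Lemma max_principle_punctured {R : realType} (g : R[i] -> R[i]) L (r M : R) :
  0 < r ->
  (forall z, 0 < normc z <= r -> exists D, has_deriv g z D) ->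
  (forall e : R, 0 < e -> exists2 k : R, 0 < k &
    forall z, 0 < normc z < k -> normc (g z - L) <= e) ->
  (forall z, normc z = r -> Re (g z) <= M) ->
  Re L <= M.
Proof.
move=> r0 gd gL gM; rewrite leNgt; apply/negP => ML.
(* Half the gap: on the small circle [Re g] is at least [Re L - e = M + e], so the integrand
   estimated below is at most [- e]. *)
pose e := (Re L - M) / 2.
have e0 : 0 < e by rewrite divr_gt0// subr_gt0.
have [k k0 Hk] := gL e e0.
pose r1 := Num.min (k / 2) r.
have r10 : 0 < r1 by rewrite lt_min r0 divr_gt0.
have r1r : r1 <= r by rewrite ge_min lexx orbT.
have r1k : r1 < k by rewrite gt_min gtr_pMr// invf_lt1// ltr1n.
pose G w := g (cexp R w).
have ln12 : ln r1 <= ln r by rewrite ler_ln ?posrE.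
have pi2 : 0 <= (pi : R) *+ 2 by rewrite mulrn_wge0// pi_ge0.
have Gd (s t : R) : ln r1 <= s <= ln r -> 0 <= t <= (pi : R) *+ 2 ->
    exists D, has_deriv G (s +i* t) D.
  move=> /andP[_ sr] _; have [|D HD] := gd (cexp R (s +i* t)).
    rewrite normc_cexp/= expR_gt0/= -(lnK r0) ler_expR //.
  eexists; exact: has_deriv_comp (has_deriv_cexp _ _) HD.
have := goursat_rect _ G _ _ _ _ ln12 pi2 Gd.
(* The horizontal sides lie at heights 0 and [2 pi], so [cexp] maps them to the same radial segment
   and the integrand vanishes. *)
rewrite [RHS](_ : _ = \int[@lebesgue_measure R]_(s in `[ln r1, ln r]) cst 0 s); last first.
  by apply: eq_Rintegral => s _; rewrite /G -[pi *+ 2]add0r cexp_2pi subrr.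
rewrite Rintegral_cst_itv// mul0r => I0.
suff : \int[@lebesgue_measure R]_(t in `[0%R, pi *+ 2])
    (Re (G (ln r +i* t)) - Re (G (ln r1 +i* t))) <= - e * (pi *+ 2 - 0).
  by rewrite I0 subr0 mulNr oppr_ge0 leNgt mulr_gt0// mulrn_wgt0// pi_gt0.
have rI : ln r1 <= ln r <= ln r by rewrite lexx andbT.
have r1I : ln r1 <= ln r1 <= ln r by rewrite lexx.
apply: Rintegral_le_cst => //.
  apply: continuous_in_subspaceT => t; rewrite inE/= in_itv/= => tI.
  have [D1 H1] := Gd _ _ rI tI; have [D2 H2] := Gd _ _ r1I tI.
  by apply: cvgB; [exact: has_deriv_continuous_Re H1|exact: has_deriv_continuous_Re H2].
move=> t _.
have N1 : normc (cexp R (ln r +i* t)) = r by rewrite normc_cexp/= lnK.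
have N2 : normc (cexp R (ln r1 +i* t)) = r1 by rewrite normc_cexp/= lnK.
have B1 := gM _ N1.
have B2 : normc (g (cexp R (ln r1 +i* t)) - L) <= e.
  by apply: Hk; rewrite N2 r10 r1k.
have B3 := le_trans (normr_Re_le _ _) B2; rewrite -/(G _) in B1 B3.
have : Re L - Re (G (ln r1 +i* t)) <= e.
  apply: le_trans B3; rewrite -normrN; apply: le_trans (ler_norm _).
  have ReB (z w : R[i]) : Re (z - w) = Re z - Re w by case: z w => ? ? [].
  by rewrite ReB opprB.
by rewrite /e; move: B1; lra.
Qed.

End MaximumPrinciple.

(** * The Parseval-type inequality for the first two coefficients *)

Section Parseval.
Variable R : realType.
Implicit Types (x y z w : R[i]).

Lemma ReD z w : Re (z + w) = Re z + Re w.
Proof. by case: z w => ? ? []. Qed.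

Lemma Re_sum m (f : 'I_m -> R[i]) : Re (\sum_j f j) = \sum_j Re (f j).
Proof. by apply: (big_morph (@complex.Re R)) => // z w; rewrite ReD. Qed.

Lemma Re_mul_conj z : Re (z * z^*) = normc z ^+ 2.
Proof. by rewrite sqr_normc_def; case: z => a b /=; rewrite mulrN opprK. Qed.

(** The limit of the auxiliary function at the puncture. The increment of [h] is at most
    [normc c + 1] times [normc z], and the quotient tends to the derivative of [k]; each error
    receives [e / 2]. *)
Lemma cvg_add_slope (h k : R[i] -> R[i]) c d : has_deriv h 0 c ->
  has_deriv k 0 d -> forall e : R, 0 < e -> exists2 r : R, 0 < r &
  forall z, 0 < normc z < r -> normc (h z + (k z - k 0) / z - (h 0 + d)) <= e.
Proof.
move=> /has_deriv_normcP hc /has_deriv_normcP kd e e0.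
have [r1 r10 H1] := hc 1 ltr01; have [|r2 r20 H2] := kd (e / 2).
  by rewrite divr_gt0.
have c0 : 0 < normc c + 1 by rewrite ltr_wpDl// normc_ge0.
exists (Num.min r1 (Num.min r2 (e / 2 / (normc c + 1)))).
  by rewrite !lt_min r10 r20 !divr_gt0.
move=> z /andP[z0]; rewrite !lt_min ltr_pdivlMr// => /and3P[z1 z2 z3].
have zN0 : z != 0.
  by apply: contraTneq z0 => ->; rewrite Normc.normc0 ltxx.
have {}H1 := H1 z z1; have {}H2 := H2 z z2.
rewrite !add0r mul1r in H1 H2.
have -> : h z + (k z - k 0) / z - (h 0 + d) =
    ((h z - h 0 - c * z) + c * z) + (k z - k 0 - d * z) / z by field.
apply: le_trans (le_normcD _ _) _; rewrite [leRHS](_ : e = e / 2 + e / 2); last by field.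
apply: lerD.
  apply: le_trans (le_normcD _ _) _; apply: le_trans (lerD H1 (lexx _)) _.
  by rewrite Normc.normcM; move: z3; rewrite mulrDr mulr1 mulrC; lra.
by rewrite Normc.normcM Normc.normcV ler_pdivrMr.
Qed.

(** The right side minus the left is half of [|x - y - w^*|^2]. *)
Lemma Re_parseval_le x y w :
  Re (x * y^* + (x - y) * w) <= (normc x ^+ 2 + normc y ^+ 2 + normc w ^+ 2) / 2.
Proof.
rewrite !sqr_normc_def; case: x y w => [x1 x2] [y1 y2] [w1 w2] /=.
have := sqr_ge0 (x1 - y1 - w1); have := sqr_ge0 (x2 - y2 + w2); lra.
Qed.

(** The function [g] of the overview is assembled from [h] and [k]; summing [Re_parseval_le] over
    the coordinates with [w = (b j)^* / z] bounds its real part on each circle. *)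
Lemma sum_sqr_coefs_le1 m (F : 'I_m -> R[i] -> R[i]) (b : 'I_m -> R[i]) :
  (forall z j, normc z < 1 -> exists d, has_deriv (F j) z d) ->
  (forall z, normc z < 1 -> \sum_j normc (F j z) ^+ 2 <= 1) ->
  (forall j, has_deriv (F j) 0 (b j)) ->
  \sum_j normc (F j 0) ^+ 2 + \sum_j normc (b j) ^+ 2 <= 1.
Proof.
move=> Fd F1 Fb; set A := (X in X + _ <= _); set B := (X in _ + X <= _).
pose h z := \sum_j F j z * (F j 0)^*; pose k z := \sum_j F j z * (b j)^*.
have derivl (c : 'I_m -> R[i]) z (d : 'I_m -> R[i]) :
    (forall j, has_deriv (F j) z (d j)) ->
    has_deriv (fun x => \sum_j F j x * c j) z (\sum_j d j * c j).
  move=> Hd; apply: has_deriv_sum => j.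
  apply: has_deriv_eq (has_derivM _ _ _ _ _ _ (Hd j) (has_deriv_cst _ (c j) z)) _.
  by rewrite mulr0 add0r mulrC.
have A0 : 0 <= A by apply: sumr_ge0 => j _; rewrite sqr_ge0.
have B0 : 0 <= B by apply: sumr_ge0 => j _; rewrite sqr_ge0.
have main (r : R) : 0 < r -> r < 1 -> A + B <= (1 + A + B / r ^+ 2) / 2.
  move=> r0 r1.
  have ReL : Re (h 0 + \sum_j b j * (b j)^*) = A + B.
    by rewrite ReD !Re_sum; congr (_ + _); apply: eq_bigr => j _; exact: Re_mul_conj.
  rewrite -[leLHS]ReL.
  apply: (@max_principle_punctured _ (fun z => h z + (k z - k 0) / z) _ r) => //.
  - move=> z /andP[z0 zr]; have z1 := le_lt_trans zr r1.
    have [d Hd] := choice (fun j => Fd z j z1).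
    have zN0 : z != 0.
      by apply: contraTneq z0 => ->; rewrite Normc.normc0 ltxx.
    eexists; apply: has_derivD; first exact: derivl Hd.
    apply: has_derivM; last exact: has_derivV zN0 (has_deriv_id _ _).
    by apply: has_derivB; [exact: derivl Hd|exact: has_deriv_cst].
  - by apply: cvg_add_slope; exact: derivl.
  - move=> z zr.
    have -> : h z + (k z - k 0) / z =
        \sum_j (F j z * (F j 0)^* + (F j z - F j 0) * ((b j)^* / z)).
      rewrite /h /k -sumrB mulr_suml -big_split/=; apply: eq_bigr => j _.
      by rewrite -mulrBl mulrA.
    rewrite Re_sum; apply: (@le_trans _ _ (\sum_j (normc (F j z) ^+ 2 +
        normc (F j 0) ^+ 2 + normc ((b j)^* / z) ^+ 2) / 2)).
      by apply: ler_sum => j _; exact: Re_parseval_le.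
    rewrite -mulr_suml ler_pM2r ?invr_gt0// !big_split/= lerD// ?lerD//.
      by apply: F1; rewrite zr.
    rewrite /B mulr_suml; apply: ler_sum => j _.
    rewrite Normc.normcM Normc.normcV zr exprMn exprVn.
    by rewrite !sqr_normc_def; case: (b j) => ? ? /=; rewrite sqrrN.
rewrite leNgt; apply/negP => AB.
(* In place of a limit [r -> 1]: [main] amounts to [C * r ^+ 2 <= B], and the midpoint [r] of
   [B / C] and 1 violates this because [(C + B)^2 > 4 * B * C]. *)
pose C := A + B + B - 1.
have CB : B < C by rewrite /C; lra.
have C0 : 0 < C by exact: le_lt_trans CB.
pose r := (C + B) / (2 * C).
have r0 : 0 < r by rewrite divr_gt0 ?mulr_gt0// ltr_pwDl.
have r1 : r < 1 by rewrite ltr_pdivrMr ?mulr_gt0//; lra.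
have := main r r0 r1; rewrite leNgt => /negP; apply.
have rC : B < C * r ^+ 2.
  have -> : C * r ^+ 2 = (C + B) ^+ 2 / (4 * C) by rewrite /r; field; rewrite gt_eqF.
  rewrite ltr_pdivlMr ?mulr_gt0//.
  have : 0 < (C - B) ^+ 2 by rewrite exprn_gt0// subr_gt0.
  by lra.
rewrite -ltr_pdivrMr ?exprn_gt0// in rC.
by move: rC; rewrite /C; lra.
Qed.

End Parseval.

(** * Disc automorphisms and the Schwarz-Pick estimate at the origin *)

Section Mobius.
Variable R : realType.
Implicit Types (a z : R[i]).

(** For [|a| < 1] this is a disc automorphism taking 0 to [a], with inverse [mobius (- a)]. *)
Definition mobius a z := (z + a) / (1 + a^* * z).

Lemma normcJ z : normc z^* = normc z.
Proof. by case: z => x y /=; rewrite sqrrN. Qed.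

Lemma mobius_den_neq0 a z : normc a < 1 -> normc z < 1 -> 1 + a^* * z != 0.
Proof.
move=> a1 z1; apply/eqP => /eqP; rewrite addr_eq0 => /eqP/(congr1 normc).
rewrite Normc.normc1 normcN Normc.normcM normcJ => E.
have : normc a * normc z < 1 by rewrite -[ltRHS]mul1r ltr_pM// normc_ge0.
by rewrite -E ltxx.
Qed.

(** Reduces the invariance of the disc to the sign of a product of positive factors. *)
Lemma one_sub_sqr_normc_mobius a z : normc a < 1 -> normc z < 1 ->
  1 - normc (mobius a z) ^+ 2 =
  (1 - normc a ^+ 2) * (1 - normc z ^+ 2) / normc (1 + a^* * z) ^+ 2.
Proof.
move=> a1 z1; have den := mobius_den_neq0 _ _ a1 z1.
have den' : normc (1 + a^* * z) ^+ 2 != 0.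
  by rewrite sqrf_eq0; apply: contraNN den => /eqP/Normc.eq0_normc ->.
rewrite /mobius Normc.normcM Normc.normcV exprMn exprVn.
apply: (mulIf den'); rewrite mulrBl mul1r !divfK//.
rewrite !sqr_normc_def; case: a z {a1 z1 den den'} => [a1 a2] [z1 z2] /=.
by ring.
Qed.

Lemma normc_mobius_lt1 a z : normc a < 1 -> normc z < 1 -> normc (mobius a z) < 1.
Proof.
move=> a1 z1; have den := mobius_den_neq0 _ _ a1 z1.
have sq (x : R[i]) : (normc x < 1) = (0 < 1 - normc x ^+ 2).
  by rewrite subr_gt0 expr_lt1// normc_ge0.
rewrite sq one_sub_sqr_normc_mobius//.
apply: divr_gt0; first by rewrite mulr_gt0// -sq.
rewrite exprn_gt0// lt_neqAle normc_ge0 andbT eq_sym.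
by apply: contraNN den => /eqP/Normc.eq0_normc ->.
Qed.

Lemma mobius0 a : mobius a 0 = a.
Proof. by rewrite /mobius mulr0 add0r addr0 divr1. Qed.

Lemma mobiusN a : mobius (- a) a = 0.
Proof. by rewrite /mobius subrr mul0r. Qed.

Lemma mulcJ z : z^* * z = (normc z ^+ 2)%:C.
Proof.
rewrite sqr_normc_def; case: z => a b; apply/eqP; rewrite eq_complex /=.
by apply/andP; split; apply/eqP; ring.
Qed.

Lemma has_deriv_mobius a z : normc a < 1 -> normc z < 1 ->
  has_deriv (mobius a) z ((1 - normc a ^+ 2)%:C / (1 + a^* * z) ^+ 2).
Proof.
move=> a1 z1; have den := mobius_den_neq0 _ _ a1 z1.
have dden : has_deriv (fun x => 1 + a^* * x) z a^*.
  apply: has_deriv_eq (has_derivD _ _ _ _ _ _ (has_deriv_cst _ 1 z)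
    (has_derivM _ _ _ _ _ _ (has_deriv_cst _ (a^*) z) (has_deriv_id _ z))) _.
  by rewrite mulr1 mulr0 addr0 add0r.
have dnum : has_deriv (fun x => x + a) z 1.
  apply: has_deriv_eq (has_derivD _ _ _ _ _ _ (has_deriv_id _ z)
    (has_deriv_cst _ a z)) _.
  by rewrite addr0.
have dinv := has_derivV _ (fun x => 1 + a^* * x) z _ den dden.
apply: has_deriv_eq (has_derivM _ _ _ _ _ _ dnum dinv) _.
by rewrite rmorphB/= rmorph1 -mulcJ; field.
Qed.

Lemma has_deriv_mobius0 a : normc a < 1 ->
  has_deriv (mobius a) 0 (1 - normc a ^+ 2)%:C.
Proof.
move=> a1; apply: has_deriv_eq (has_deriv_mobius _ _ a1 _) _.
  by rewrite Normc.normc0.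
by rewrite mulr0 addr0 expr1n divr1.
Qed.

Lemma has_deriv_mobiusN a : normc a < 1 ->
  has_deriv (mobius (- a)) a ((1 - normc a ^+ 2)^-1)%:C.
Proof.
move=> a1; have a1' : normc (- a) < 1 by rewrite normcN.
apply: has_deriv_eq (has_deriv_mobius _ _ a1' a1) _.
have d0 : 1 - normc a ^+ 2 != 0.
  by rewrite gt_eqF// subr_gt0 expr_lt1// normc_ge0.
rewrite normcN rmorphN mulNr mulcJ -(rmorph1 (real_complex R)) -rmorphB -rmorphXn.
rewrite -fmorphV -rmorphM/=; congr (_%:C).
by field.
Qed.

(** After composition with [mobius (- f 0)] the constant term is 0, so the one-coordinate case of
    [sum_sqr_coefs_le1] bounds the new derivative by 1; that derivative is [d] divided by
    [1 - |f(0)|^2]. *)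
Lemma schwarz_pick_at0 (f : R[i] -> R[i]) d :
  (forall z, normc z < 1 -> exists d, has_deriv f z d) ->
  (forall z, normc z < 1 -> normc (f z) < 1) ->
  has_deriv f 0 d -> normc d <= 1 - normc (f 0) ^+ 2.
Proof.
move=> fd f1 f0d; have n0 : normc (0 : R[i]) < 1 by rewrite Normc.normc0.
have a1 := f1 _ n0; have a1' : normc (- f 0) < 1 by rewrite normcN.
have D0 : 0 < 1 - normc (f 0) ^+ 2 by rewrite subr_gt0 expr_lt1// normc_ge0.
have := @sum_sqr_coefs_le1 _ 1 (fun=> fun z => mobius (- f 0) (f z))
  (fun=> ((1 - normc (f 0) ^+ 2)^-1)%:C * d).
rewrite !big_ord1 mobiusN Normc.normc0 expr0n add0r => H.
have : normc (((1 - normc (f 0) ^+ 2)^-1)%:C * d) ^+ 2 <= 1.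
  apply: H.
  - move=> z _ z1; have [c Hc] := fd _ z1; eexists.
    exact: has_deriv_comp Hc (has_deriv_mobius _ _ a1' (f1 _ z1)).
  - move=> z z1; rewrite big_ord1 exprn_ile1 ?normc_ge0// ltW//.
    by apply: normc_mobius_lt1 => //; exact: f1.
  - by move=> _; exact: has_deriv_comp f0d (has_deriv_mobiusN _ a1).
rewrite expr_le1 ?normc_ge0// Normc.normcM normc_real.
rewrite ger0_norm; last by rewrite invr_ge0 ltW.
by rewrite mulrC ler_pdivrMr// mul1r.
Qed.

End Mobius.

(** * Hermitian geometry of row vectors *)

Section Euclidean.
Variable R : realType.
Variable n : nat.
Implicit Types (x v : 'rV[R[i]]_n) (c : R[i]).

(** The Hermitian product, linear in its first argument. Written as a product with a fixed column,
    it fits [is_diff_ridge]. *)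
Definition cdot x v : R[i] := (x *m (map_mx conjc v)^T) ord0 ord0.

Lemma cdotE x v : cdot x v = \sum_j x ord0 j * (v ord0 j)^*.
Proof. by rewrite /cdot mxE; apply: eq_bigr => j _; rewrite !mxE. Qed.

Lemma enorm_ge0 x : 0 <= enorm x.
Proof. by rewrite sqrtr_ge0. Qed.

Lemma sqr_enorm x : enorm x ^+ 2 = \sum_j normc (x ord0 j) ^+ 2.
Proof. by rewrite sqr_sqrtr// sumr_ge0// => j _; rewrite sqr_ge0. Qed.

Lemma enorm_lt1 x : (enorm x < 1) = (enorm x ^+ 2 < 1).
Proof. by rewrite expr_lt1// enorm_ge0. Qed.

Lemma cdotDl x y v : cdot (x + y) v = cdot x v + cdot y v.
Proof. by rewrite /cdot mulmxDl mxE. Qed.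

Lemma cdotZl c x v : cdot (c *: x) v = c * cdot x v.
Proof. by rewrite /cdot -scalemxAl mxE. Qed.

Lemma cdotxx v : cdot v v = (enorm v ^+ 2)%:C.
Proof.
rewrite cdotE sqr_enorm rmorph_sum/=; apply: eq_bigr => j _.
by rewrite mulrC mulcJ.
Qed.

Lemma enormZ c x : enorm (c *: x) = normc c * enorm x.
Proof.
apply/eqP; rewrite -(eqrXn2 (n := 2))// ?mulr_ge0 ?enorm_ge0 ?normc_ge0//.
rewrite exprMn !sqr_enorm mulr_sumr; apply/eqP; apply: eq_bigr => j _.
by rewrite mxE Normc.normcM exprMn.
Qed.

Lemma sqr_enormDZ x c v : enorm (x + c *: v) ^+ 2 =
  enorm x ^+ 2 + normc c ^+ 2 * enorm v ^+ 2 + 2 * Re (c^* * cdot x v).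
Proof.
rewrite !sqr_enorm cdotE !mulr_sumr Re_sum !mulr_sumr -!big_split/=.
apply: eq_bigr => j _; rewrite !mxE !sqr_normc_def.
case: (x ord0 j) (v ord0 j) c => [x1 x2] [v1 v2] [c1 c2] /=.
by ring.
Qed.

Lemma sqr_enorm_orthD x c v : cdot x v = 0 ->
  enorm (x + c *: v) ^+ 2 = enorm x ^+ 2 + normc c ^+ 2 * enorm v ^+ 2.
Proof. by move=> xv; rewrite sqr_enormDZ xv mulr0 /= mulr0 addr0. Qed.

Lemma cdot_proj x v : enorm v = 1 -> cdot (x - cdot x v *: v) v = 0.
Proof.
by move=> v1; rewrite -scaleNr cdotDl cdotZl cdotxx v1 expr1n mulr1 subrr.
Qed.

(** Pythagoras for [x] split into its projection on [v] and the remainder. *)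
Lemma sqr_enorm_proj x v : enorm v = 1 ->
  enorm (x - cdot x v *: v) ^+ 2 = enorm x ^+ 2 - normc (cdot x v) ^+ 2.
Proof.
move=> v1; have := sqr_enorm_orthD _ (cdot x v) _ (cdot_proj x v v1).
by rewrite subrK v1 expr1n mulr1 => ->; rewrite addrK.
Qed.

(** Cauchy-Schwarz, read off from the nonnegative squared norm of the remainder. *)
Lemma normc_cdot_le x v : enorm v = 1 -> normc (cdot x v) <= enorm x.
Proof.
move=> v1; rewrite -(ler_sqr (_ : _ \is Num.nneg)) ?nnegrE ?normc_ge0 ?enorm_ge0//.
by rewrite -subr_ge0 -sqr_enorm_proj// sqr_ge0.
Qed.

Lemma enorm_eq0 x : enorm x = 0 -> x = 0.
Proof.
move=> x0; apply/rowP => j; rewrite mxE; apply: Normc.eq0_normc.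
have := sqr_enorm x; rewrite x0 expr0n => /esym/eqP.
rewrite psumr_eq0 => [/allP/(_ j)|i _]; last exact: sqr_ge0.
by rewrite mem_index_enum sqrf_eq0 => /(_ isT)/eqP.
Qed.

Lemma normalize x : x != 0 -> enorm ((enorm x)^-1%:C *: x) = 1.
Proof.
move=> x0; have xn0 : enorm x != 0 by apply: contraNN x0 => /eqP/enorm_eq0 ->.
by rewrite enormZ normc_real ger0_norm ?invr_ge0 ?enorm_ge0// mulVf.
Qed.

Lemma exists_unit_row : (0 < n)%N -> exists v, enorm v = 1.
Proof.
move=> n0; pose v : 'rV[R[i]]_n := const_mx 1.
exists ((enorm v)^-1%:C *: v); apply: normalize.
by apply/eqP => /rowP/(_ (Ordinal n0)); rewrite !mxE => /eqP; rewrite oner_eq0.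
Qed.

(** For nonzero [x] take [x] normalised: the remainder of the projection then has norm 0. For
    [x = 0] any unit vector serves. *)
Lemma exists_unit_line x : (0 < n)%N ->
  exists2 v, enorm v = 1 & x = cdot x v *: v.
Proof.
move=> n0; have [->|x0] := eqVneq x 0.
  have [v v1] := exists_unit_row n0; exists v => //.
  by rewrite /cdot mul0mx mxE scale0r.
pose v := (enorm x)^-1%:C *: x; have v1 := normalize _ x0.
exists v => //; apply/eqP; rewrite -subr_eq0; apply/eqP/enorm_eq0/eqP.
rewrite -sqrf_eq0 sqr_enorm_proj// subr_eq0; apply/eqP.
have xE : x = (enorm x)%:C *: v.
  rewrite scalerA -rmorphM/= mulfV ?scale1r//.
  by apply: contraNN x0 => /eqP/enorm_eq0 ->.
have -> : cdot x v = (enorm x)%:C.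
  by rewrite {1}xE cdotZl cdotxx v1 expr1n mulr1.
by rewrite normc_real ger0_norm// enorm_ge0.
Qed.

(** The kernel of the column [x^T] has dimension at least [n - 1], hence a nonzero element;
    conjugating its entries turns the bilinear relation into Hermitian orthogonality. *)
Lemma exists_unit_orth x : (2 <= n)%N -> exists2 u, enorm u = 1 & cdot x u = 0.
Proof.
move=> n2; have : kermx x^T != 0.
  rewrite -mxrank_eq0 mxrank_ker -lt0n subn_gt0.
  by apply: leq_ltn_trans (rank_leq_col _) _.
move=> /rowV0Pn[u /sub_kermxP ux u0].
pose u' : 'rV[R[i]]_n := map_mx conjc u.
have u'0 : u' != 0.
  apply: contraNN u0 => /eqP/rowP uE; apply/eqP/rowP => j.
  by have := uE j; rewrite !mxE => /eqP; rewrite conjc_eq0 => /eqP.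
exists ((enorm u')^-1%:C *: u'); first exact: normalize.
rewrite cdotE (eq_bigr (fun j => (enorm u')^-1%:C * (u ord0 j * x ord0 j))).
  have -> : \sum_j (enorm u')^-1%:C * (u ord0 j * x ord0 j) =
      (enorm u')^-1%:C * (u *m x^T) ord0 ord0.
    by rewrite mxE mulr_sumr; apply: eq_bigr => j _; rewrite mxE.
  by rewrite ux mxE mulr0.
move=> j _; have -> : ((enorm u')^-1%:C *: u') ord0 j =
    (enorm u')^-1%:C * (u ord0 j)^* by rewrite !mxE.
move: (_^-1) (u ord0 j) (x ord0 j) => r [u1 u2] [x1 x2].
by apply/eqP; rewrite eq_complex /=; apply/andP; split; apply/eqP; ring.
Qed.

End Euclidean.

(** * Derivative bounds for maps between balls *)

Section BallMaps.
Local Open Scope classical_set_scope.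
Variable R : realType.

(* The disc cut out of the ball by the complex line through [z] in direction
   [v], reparametrised by a Moebius map so that its origin is sent to [z]. *)
Lemma exists_disc_through n (z v : 'rV[R[i]]_n) : unit_ball R n z ->
  enorm v = 1 -> exists q p (l : R),
  [/\ 1 - enorm z ^+ 2 <= l, z = p + q 0 *: v, has_deriv q 0 l%:C,
      forall t, normc t < 1 -> exists d, has_deriv q t d &
      forall t, normc t < 1 -> unit_ball R n (p + q t *: v)].
Proof.
rewrite /unit_ball/= enorm_lt1 => z1 v1.
pose tau := cdot _ _ z v; pose p := z - tau *: v.
have pv : cdot _ _ p v = 0 by exact: cdot_proj.
have pE : enorm p ^+ 2 = enorm z ^+ 2 - normc tau ^+ 2 by exact: sqr_enorm_proj.
(* The line meets the ball in the disc with centre [p] and radius [rho]; [alpha] below is the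
   position of [z] in it after rescaling to the unit disc. *)
pose rho := Num.sqrt (1 - enorm p ^+ 2).
have tau2 : 0 <= normc tau ^+ 2 by exact: sqr_ge0.
have D0 : 0 < 1 - enorm p ^+ 2 by rewrite pE; lra.
have rho2 : rho ^+ 2 = 1 - enorm p ^+ 2 by rewrite sqr_sqrtr// ltW.
have rho0 : 0 < rho by rewrite sqrtr_gt0.
have rho1 : rho <= 1.
  by rewrite -(expr_le1 (n := 2)) ?(ltW rho0)// rho2 lerBlDr lerDl sqr_ge0.
have rhoC : rho%:C != 0 :> R[i] by rewrite (inj_eq (@complexI R)) gt_eqF.
pose alpha := tau / rho%:C.
have alpha2 : normc alpha ^+ 2 = normc tau ^+ 2 / rho ^+ 2.
  by rewrite Normc.normcM Normc.normcV normc_real ger0_norm ?(ltW rho0)// exprMn exprVn.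
have alpha1 : normc alpha < 1.
  rewrite -(expr_lt1 (n := 2)) ?normc_ge0// alpha2 ltr_pdivrMr ?exprn_gt0//.
  by rewrite mul1r rho2 pE; lra.
pose q t := rho%:C * mobius _ alpha t.
have qd t d : has_deriv (mobius _ alpha) t d -> has_deriv q t (rho%:C * d).
  move=> Hd; apply: has_deriv_eq (has_derivM _ _ _ _ _ _ (has_deriv_cst _ rho%:C t) Hd) _.
  by rewrite mulr0 addr0.
(* This derivative equals [(1 - |z|^2) / rho], which is at least [1 - |z|^2] because [rho <= 1]. *)
exists q, p, (rho * (1 - normc alpha ^+ 2)); split.
- have -> : rho * (1 - normc alpha ^+ 2) = (1 - enorm z ^+ 2) / rho.
    rewrite alpha2; have -> : 1 - enorm z ^+ 2 = rho ^+ 2 - normc tau ^+ 2.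
      by rewrite rho2 pE; ring.
    by field; rewrite gt_eqF.
  by rewrite ler_pdivlMr// ler_piMr// ltW// subr_gt0.
- by rewrite /q mobius0 /alpha mulrC divfK// subrK.
- by rewrite rmorphM/=; apply: qd; exact: has_deriv_mobius0.
- by move=> t t1; eexists; apply: qd; exact: has_deriv_mobius.
- move=> t t1; rewrite /unit_ball/= enorm_lt1 sqr_enorm_orthD// v1 expr1n mulr1.
  rewrite -ltrBrDl -rho2 Normc.normcM normc_real ger0_norm ?(ltW rho0)// exprMn.
  by rewrite gtr_pMr ?exprn_gt0// expr_lt1 ?normc_ge0// normc_mobius_lt1.
Qed.

Section AtPoint.
Variables (n m : nat) (f : 'rV[R[i]]_n -> 'rV[R[i]]_m) (z v : 'rV[R[i]]_n).
Hypotheses (hf : holomorphic_ball_map f) (hz : unit_ball R n z) (hv : enorm v = 1).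

Let D0 : 0 < 1 - enorm z ^+ 2.
Proof. by rewrite subr_gt0 -enorm_lt1. Qed.

(** The Parseval-type inequality is applied along the disc through [z]: the derivative at 0 is [l]
    times ['d f z v], and [l] is at least [1 - |z|^2]. *)
Lemma enorm_diff_le_sqrt :
  enorm ('d f z v) <= Num.sqrt (1 - enorm (f z) ^+ 2) / (1 - enorm z ^+ 2).
Proof.
have [q [p [l [lz zE q0 qd qB]]]] := exists_disc_through _ _ _ hz hv.
have l0 : 0 < l by exact: lt_le_trans lz.
have fz1 : 0 <= 1 - enorm (f z) ^+ 2.
  by rewrite subr_ge0 ltW// -enorm_lt1; exact: hf.2.
have H : enorm (f z) ^+ 2 + (l * enorm ('d f z v)) ^+ 2 <= 1.
  have := @sum_sqr_coefs_le1 _ m (fun j t => f (p + q t *: v) ord0 j)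
    (fun j => l%:C * 'd f (p + q 0 *: v) v ord0 j).
  rewrite -zE -sqr_enorm => H.
  have -> : (l * enorm ('d f z v)) ^+ 2 =
      \sum_j normc (l%:C * 'd f z v ord0 j) ^+ 2.
    rewrite exprMn sqr_enorm mulr_sumr; apply: eq_bigr => j _.
    by rewrite Normc.normcM normc_real ger0_norm ?(ltW l0)// exprMn.
  apply: H.
  - move=> t j t1; have [d Hd] := qd _ t1; eexists.
    by apply: has_deriv_coord_line Hd; apply: hf.1; exact: qB.
  - move=> t t1; rewrite -sqr_enorm ltW// -enorm_lt1; apply: hf.2; exact: qB.
  - move=> j; have := has_deriv_coord_line _ _ _ f q p v 0 l%:C j.
    by rewrite -zE; apply => //; exact: hf.1.
rewrite ler_pdivlMr//.
rewrite -(ler_sqr (_ : _ \is Num.nneg)) ?nnegrE ?sqrtr_ge0 ?mulr_ge0 ?enorm_ge0 ?(ltW D0)//.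
rewrite [leRHS]sqr_sqrtr// lerBrDl; apply: le_trans H; rewrite lerD2l mulrC.
by rewrite ler_sqr ?nnegrE ?mulr_ge0 ?enorm_ge0 ?(ltW D0) ?(ltW l0)// ler_wpM2r ?enorm_ge0.
Qed.

(** The modulus of the only coordinate is the whole norm, so [schwarz_pick_at0] applies along the
    same disc. *)
Lemma enorm_diff_le_dim1 : m = 1%N ->
  enorm ('d f z v) <= (1 - enorm (f z) ^+ 2) / (1 - enorm z ^+ 2).
Proof.
move=> m1; have [q [p [l [lz zE q0 qd qB]]]] := exists_disc_through _ _ _ hz hv.
have l0 : 0 < l by exact: lt_le_trans lz.
have [j enormE] : exists j, forall w : 'rV[R[i]]_m, enorm w = normc (w ord0 j).
  clear -m1; rewrite m1; exists ord0 => w.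
  by rewrite /enorm big_ord1 sqrtr_sqr ger0_norm ?normc_ge0.
have := @schwarz_pick_at0 _ (fun t => f (p + q t *: v) ord0 j)
  (l%:C * 'd f (p + q 0 *: v) v ord0 j).
rewrite -zE -!enormE Normc.normcM -enormE normc_real ger0_norm ?(ltW l0)// => H.
rewrite ler_pdivlMr//; apply: (@le_trans _ _ (l * enorm ('d f z v))).
  by rewrite mulrC ler_wpM2r ?enorm_ge0.
apply: H.
- move=> t t1; have [d Hd] := qd _ t1; eexists.
  by apply: has_deriv_coord_line Hd; apply: hf.1; exact: qB.
- by move=> t t1; rewrite -enormE; apply: hf.2; exact: qB.
- have := has_deriv_coord_line _ _ _ f q p v 0 l%:C j.
  by rewrite -zE; apply => //; exact: hf.1.
Qed.

End AtPoint.

(** * Operator norms and extremal maps *)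

Lemma opnorm_le n m (A : 'rV[R[i]]_n -> 'rV[R[i]]_m) (k : R) : (0 < n)%N ->
  (forall v, enorm v = 1 -> enorm (A v) <= k) -> opnorm A <= k.
Proof.
move=> n0 Ak; apply: ge_sup; last by move=> _ [v /= v1 <-]; exact: Ak.
(* [ge_sup] asks for a nonempty set, and [n > 0] provides a unit vector. *)
by have [v v1] := exists_unit_row R n n0; exists (enorm (A v)), v.
Qed.

Lemma opnorm_eq n m (A : 'rV[R[i]]_n -> 'rV[R[i]]_m) (k : R) v :
  (forall u, enorm u = 1 -> enorm (A u) <= k) -> enorm v = 1 ->
  enorm (A v) = k -> opnorm A = k.
Proof.
move=> Ak v1 Av; apply/eqP; rewrite eq_le; apply/andP; split.
  by apply: ge_sup; [exists k, v|move=> _ [u /= u1 <-]; exact: Ak].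
by apply: ub_le_sup; [exists k => _ [u /= u1 <-]; exact: Ak|exists v].
Qed.

(* Equality is attained by maps depending on one linear coordinate only. *)
Lemma exists_ridge_extremal n m (z : 'rV[R[i]]_n) (w u : 'rV[R[i]]_m)
    (phi : R[i] -> R[i]) (d : R) : (0 < n)%N -> unit_ball R n z -> 0 <= d ->
  (forall t, normc t < 1 -> exists c, has_deriv phi t c) ->
  (forall t, normc t < 1 -> unit_ball R m (w + phi t *: u)) ->
  has_deriv phi 0 d%:C -> enorm u = 1 ->
  exists f : 'rV[R[i]]_n -> 'rV[R[i]]_m, exists2 v,
    [/\ holomorphic_ball_map f, f z = w + phi 0 *: u & enorm v = 1] &
    enorm ('d f z v) = d / (1 - enorm z ^+ 2).
Proof.
move=> n0 z1 d0 phid phiB phi0 u1.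
(* With [z] on the line spanned by [v], the disc in direction [v] has centre 0 and radius 1, so the
   estimate [rho <= 1] loses nothing there. *)
have [v v1 zE] := exists_unit_line _ _ z n0.
pose tau := cdot _ _ z v.
have tauE : normc tau = enorm z by rewrite [in RHS]zE enormZ v1 mulr1.
have tau1 : normc tau < 1 by rewrite tauE.
have tau1' : normc (- tau) < 1 by rewrite normcN.
(* Moving [tau] to 0 multiplies the derivative of [phi] at 0 by [1 / (1 - |z|^2)]. *)
pose psi t := phi (mobius _ (- tau) t).
have psid t c : normc t < 1 -> has_deriv phi (mobius _ (- tau) t) c ->
    has_deriv psi t (c * ((1 - normc (- tau) ^+ 2)%:C / (1 + (- tau)^* * t) ^+ 2)).
  by move=> t1 Hc; apply: has_deriv_comp Hc; exact: has_deriv_mobius.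
have cdot1 x : unit_ball R n x -> normc (cdot _ _ x v) < 1.
  by apply: le_lt_trans; exact: normc_cdot_le.
exists (fun x => w + psi (cdot _ _ x v) *: u), v; first split.
- split => x x1; last by apply: phiB; apply: normc_mobius_lt1 (cdot1 _ x1).
  have m1 := normc_mobius_lt1 _ _ _ tau1' (cdot1 _ x1).
  have [c Hc] := phid _ m1.
  by have [xd _] := is_diff_ridge _ _ _ psi _ w u x _ (psid _ _ (cdot1 _ x1) Hc).
- by rewrite /psi -/tau mobiusN.
- exact: v1.
have psi_tau : has_deriv psi tau (d%:C * ((1 - normc tau ^+ 2)^-1)%:C).
  apply: has_deriv_comp; last by rewrite mobiusN.
  exact: has_deriv_mobiusN.
have [_ ->] := is_diff_ridge _ _ _ psi _ w u z _ psi_tau.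
rewrite -/(cdot _ _ v v) cdotxx v1 expr1n mulr1 enormZ u1 mulr1.
rewrite Normc.normcM !normc_real tauE -normrM ger0_norm// mulr_ge0// invr_ge0 subr_ge0.
by rewrite exprn_ile1 ?enorm_ge0// ltW.
Qed.

(** A second dimension leaves room for a unit [u] orthogonal to [w]. Moving from [w] along [u] by
    less than [s = sqrt (1 - |w|^2)] stays in the ball by Pythagoras, so the linear profile [s * t]
    is admissible. *)
Lemma exists_extremal n m (z : 'rV[R[i]]_n) (w : 'rV[R[i]]_m) :
  (0 < n)%N -> (2 <= m)%N -> unit_ball R n z -> unit_ball R m w ->
  exists f : 'rV[R[i]]_n -> 'rV[R[i]]_m,
    [/\ holomorphic_ball_map f, f z = w &
     opnorm ('d f z) = Num.sqrt (1 - enorm (f z) ^+ 2) / (1 - enorm z ^+ 2)].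
Proof.
move=> n0 m2 z1 w1; have [u u1 wu] := exists_unit_orth _ _ w m2.
pose s := Num.sqrt (1 - enorm w ^+ 2).
have s0 : 0 <= s by rewrite sqrtr_ge0.
have w2 : enorm w ^+ 2 < 1 by rewrite -enorm_lt1.
have s2 : s ^+ 2 = 1 - enorm w ^+ 2 by rewrite sqr_sqrtr// subr_ge0 ltW.
have phid t : has_deriv (fun t : R[i] => s%:C * t) t s%:C.
  apply: has_deriv_eq (has_derivM _ _ _ _ _ _ (has_deriv_cst _ s%:C t) (has_deriv_id _ t)) _.
  by rewrite mulr1 mulr0 addr0.
have [||f [v [hf]]] :=
    @exists_ridge_extremal n m z w u (fun t => s%:C * t) s n0 z1 s0 _ _ (phid 0) u1.
- by move=> t _; exists s%:C.
- move=> t t1; rewrite /unit_ball/= enorm_lt1 sqr_enorm_orthD// u1 expr1n mulr1.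
  rewrite Normc.normcM normc_real ger0_norm// exprMn s2 -ltrBrDl.
  by rewrite gtr_pMr ?subr_gt0// expr_lt1 ?normc_ge0.
rewrite mulr0 scale0r addr0 => fz v1 dv; exists f; split => //.
apply: opnorm_eq v1 _; last by rewrite fz.
by move=> x x1; exact: enorm_diff_le_sqrt.
Qed.

(** The profile is the Möbius map with value [w] at 0, whose derivative there is [1 - |w|^2]. *)
Lemma exists_extremal_dim1 n m (z : 'rV[R[i]]_n) (w : 'rV[R[i]]_m) :
  (0 < n)%N -> m = 1%N -> unit_ball R n z -> unit_ball R m w ->
  exists f : 'rV[R[i]]_n -> 'rV[R[i]]_m,
    [/\ holomorphic_ball_map f, f z = w &
     opnorm ('d f z) = (1 - enorm (f z) ^+ 2) / (1 - enorm z ^+ 2)].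
Proof.
move=> n0 m1 z1 w1.
have [u u1 [j wE]] : exists2 u : 'rV[R[i]]_m, enorm u = 1 &
    exists j, forall x : 'rV[R[i]]_m, x = x ord0 j *: u.
  clear -m1; rewrite m1; exists (const_mx 1).
    by rewrite /enorm big_ord1 mxE Normc.normc1 expr1n sqrtr1.
  by exists ord0 => x; apply/rowP => i; rewrite !mxE mulr1 ord1.
have enormE (x : 'rV[R[i]]_m) : enorm x = normc (x ord0 j).
  by rewrite [in LHS](wE x) enormZ u1 mulr1.
pose a := w ord0 j.
have a1 : normc a < 1 by rewrite -enormE.
have d0 : 0 <= 1 - normc a ^+ 2 by rewrite subr_ge0 exprn_ile1 ?normc_ge0// ltW.
have [||f [v [hf]]] :=
    @exists_ridge_extremal n m z 0 u (mobius _ a) _ n0 z1 d0 _ _ (has_deriv_mobius0 _ _ a1) u1.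
- by move=> t t1; eexists; exact: has_deriv_mobius.
- move=> t t1; rewrite /unit_ball/= add0r enormZ u1 mulr1.
  exact: normc_mobius_lt1.
rewrite add0r mobius0 -wE => fz v1 dv; exists f; split => //.
apply: opnorm_eq v1 _; last by rewrite dv fz -enormE.
by move=> x x1; exact: (enorm_diff_le_dim1 _ _ _ _ _ hf z1 x1 m1).
Qed.

End BallMaps.

Theorem theorem2p1 (R : realType) (n m : nat) (hn : (0 < n)%N) (hm : (0 < m)%N) :
  (* (i) and (ii) *)
  (forall f : 'rV[R[i]]_n -> 'rV[R[i]]_m, holomorphic_ball_map f ->
     ((2 <= m)%N -> forall z, unit_ball R n z ->
        opnorm ('d f z) <= Num.sqrt (1 - enorm (f z) ^+ 2) / (1 - enorm z ^+ 2)) /\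
     (m = 1%N -> forall z, unit_ball R n z ->
        opnorm ('d f z) <= (1 - enorm (f z) ^+ 2) / (1 - enorm z ^+ 2))) /\
  (* sharpness of (i) and (ii): equality is attained at every point z and for
     every prescribed value w = f z *)
  (forall (z : 'rV[R[i]]_n) (w : 'rV[R[i]]_m), unit_ball R n z -> unit_ball R m w ->
     ((2 <= m)%N -> exists f : 'rV[R[i]]_n -> 'rV[R[i]]_m,
        [/\ holomorphic_ball_map f, f z = w &
            opnorm ('d f z) = Num.sqrt (1 - enorm (f z) ^+ 2) / (1 - enorm z ^+ 2)]) /\
     (m = 1%N -> exists f : 'rV[R[i]]_n -> 'rV[R[i]]_m,
        [/\ holomorphic_ball_map f, f z = w &
            opnorm ('d f z) = (1 - enorm (f z) ^+ 2) / (1 - enorm z ^+ 2)])) /\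
  (* the case z = 0 *)
  (forall f : 'rV[R[i]]_n -> 'rV[R[i]]_m, holomorphic_ball_map f ->
     opnorm ('d f 0) <= if (2 <= m)%N then Num.sqrt (1 - enorm (f 0) ^+ 2)
                        else 1 - enorm (f 0) ^+ 2) /\
  (* sharpness in the case z = 0 *)
  (forall w : 'rV[R[i]]_m, unit_ball R m w ->
     exists f : 'rV[R[i]]_n -> 'rV[R[i]]_m,
       [/\ holomorphic_ball_map f, f 0 = w &
           opnorm ('d f 0) = if (2 <= m)%N then Num.sqrt (1 - enorm (f 0) ^+ 2)
                             else 1 - enorm (f 0) ^+ 2]).
Proof.
have B0 : unit_ball R n 0.
  by rewrite /unit_ball /= -(scale0r 0) enormZ Normc.normc0 mul0r.
have E0 : 1 - enorm (0 : 'rV[R[i]]_n) ^+ 2 = 1.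
  by rewrite -(scale0r 0) enormZ Normc.normc0 mul0r expr0n subr0.
(* [hm] excludes [m = 0], so the else branch is exactly the case [m = 1]. *)
have dim1 : (2 <= m)%N = false -> m = 1%N by case: m hm => [|[|]].
split; [|split; [|split]].
- move=> f hf; split=> hm' z hz; apply: opnorm_le => // v hv.
    exact: enorm_diff_le_sqrt.
  exact: enorm_diff_le_dim1.
- move=> z w hz hw; split=> hm'; first exact: exists_extremal.
  exact: exists_extremal_dim1.
- move=> f hf; apply: opnorm_le => // v hv; case: ifP => hm'.
    by have := enorm_diff_le_sqrt _ _ _ _ _ _ hf B0 hv; rewrite E0 divr1.
  have := enorm_diff_le_dim1 _ _ _ _ _ _ hf B0 hv (dim1 hm').
  by rewrite E0 divr1.
- move=> w hw; case hm': (2 <= m)%N.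
    have [f [hf fw fE]] := exists_extremal _ _ _ _ _ hn hm' B0 hw.
    by exists f; split => //; rewrite fE E0 divr1.
  have [f [hf fw fE]] := exists_extremal_dim1 _ _ _ _ _ hn (dim1 hm') B0 hw.
  by exists f; split => //; rewrite fE E0 divr1.
Qed.
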